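(* Let $\mathcal{C}$ be a full subcategory of the category of non-empty path-connected spaces and continuous maps, having the closed unit disk $D^2$ as an object. Let $X$ be a path-connected space with basepoint $x_0\in X$ and let $G=\pi_1(X,x_0)$. Then the monodromy functor $\mu:\mathbf{Cov}_{\mathcal{C}}(X)\to G\mathbf{Set}$ is fully faithful.
   Context: Maps are continuous functions. For a based map $f$, $f_*$ is the induced homomorphism on fundamental groups. A $\mathcal{C}$-covering map is a map $p:\widetilde{X}\to X$ such that (1) $\widetilde{X}\in\mathcal{C}$, and (2) for every $Y\in\mathcal{C}$, every $\tilde{x}\in\widetilde{X}$, every $y\in Y$, and every based map $f:(Y,y)\to(X,p(\tilde{x}))$ with $f_*(\pi_1(Y,y))\subseteq p_*(\pi_1(\widetilde{X},\tilde{x}))$, there is a unique map $\tilde{f}:(Y,y)\to(\widetilde{X},\tilde{x})$ with $p\circ\tilde{f}=f$. $\mathbf{Cov}_{\mathcal{C}}(X)$ is the category whose objects are the $\mathcal{C}$-coverings $p:\widetilde{X}\to X$ over $X$; a morphism from $p:E\to X$ to $q:E'\to X$ is a map $f:E\to E'$ with $q\circ f=p$. Since $D^2\in\mathcal{C}$, every path $\alpha:[0,1]\to X$ and every $e\in p^{-1}(\alpha(0))$ determine a unique lift $\widetilde{\alpha}_e$ of $\alpha$ starting at $e$, and homotopies of paths (rel. endpoints) lift too. The functor $\mu$ sends $p$ to the fiber $p^{-1}(x_0)$ with the monodromy action of $G$ by endpoints of lifts of loops (as a left action: $[\alpha]\cdot e=\widetilde{\alpha^-}_e(1)$ where $\alpha^-(t)=\alpha(1-t)$),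 and sends a morphism $f$ to its restriction $p^{-1}(x_0)\to q^{-1}(x_0)$. $G\mathbf{Set}$ is the category of $G$-sets and $G$-equivariant functions. *)

(* Defs.v *)
From HB Require Import structures.
From mathcomp Require Import all_boot all_order all_algebra generic_quotient.
From mathcomp Require Import all_classical.
From mathcomp Require Import reals topology normedtype homotopy.
From mathcomp Require Import lra.

Set Implicit Arguments.
Unset Strict Implicit.
Unset Printing Implicit Defensive.
Import Order.TTheory GRing.Theory Num.Theory.
Import numFieldNormedType.Exports.
Local Open Scope classical_set_scope.
Local Open Scope ring_scope.
Local Open Scope quotient_scope.

Definition unit_interval (R : realType) : Type := set_type `[0:R, 1].

HB.instance Definition _ (R : realType) :=
  Topological.copy (unit_interval R) (set_type `[0:R, 1]).

Definition disk (R : realType) : topologicalType :=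
  set_type [set z : R * R | z.1 ^+ 2 + z.2 ^+ 2 <= 1].

Section Interval.
Variable R : realType.
Local Notation I := (unit_interval R).

Lemma clamp_subproof (t : R) : Num.max 0 (Num.min t 1) \in `[0:R, 1]%classic.
Proof.
rewrite inE /= in_itv /= le_max lexx /= ge_max ler01 /=.
by rewrite ge_min lexx orbT.
Qed.

(* The retraction of R onto the unit interval: with it, parameters such as 2t
   and 2t - 1 need no membership proof. *)
Definition clamp (t : R) : I := SigSub (clamp_subproof t).

Definition ival (t : I) : R := set_val t.

Lemma ival_ge0 (t : I) : 0 <= ival t.
Proof. by case: t => t /= tI; have := set_mem tI; rewrite /= in_itv => /andP[]. Qed.

Lemma ival_le1 (t : I) : ival t <= 1.
Proof. by case: t => t /= tI; have := set_mem tI; rewrite /= in_itv => /andP[]. Qed.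

Lemma clampE (t : R) : ival (clamp t) = Num.max 0 (Num.min t 1).
Proof. by []. Qed.

Lemma ivalK : cancel ival clamp.
Proof.
move=> t; apply: val_inj => /=.
by rewrite -/(ival t) min_l ?ival_le1// max_r// ival_ge0.
Qed.

Lemma ival_inj : injective ival.
Proof. exact: can_inj ivalK. Qed.

Lemma clamp_id (t : R) : 0 <= t <= 1 -> ival (clamp t) = t.
Proof. by move=> /andP[t0 t1]; rewrite clampE min_l// max_r. Qed.

Lemma clamp_le0 (t : R) : t <= 0 -> clamp t = clamp 0.
Proof.
move=> t0; apply: ival_inj; rewrite !clampE !min_l ?ler01//; last first.
  exact: le_trans ler01.
by rewrite maxxx max_l.
Qed.

Lemma clamp_ge1 (t : R) : 1 <= t -> clamp t = clamp 1.
Proof. by move=> t1; apply: ival_inj; rewrite !clampE minxx min_r. Qed.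

Lemma clamp01 : clamp 0 != clamp 1.
Proof.
apply/eqP => /(congr1 ival); rewrite !clamp_id ?lexx ?ler01// => /eqP.
by rewrite eq_sym oner_eq0.
Qed.

HB.instance Definition _ := isBiPointed.Build I clamp01.

Lemma clamp0E : clamp 0 = zero :> I. Proof. by []. Qed.
Lemma clamp1E : clamp 1 = one :> I. Proof. by []. Qed.

Lemma ival0 : ival zero = 0.
Proof. by rewrite -clamp0E clamp_id// lexx ler01. Qed.
Lemma ival1 : ival one = 1.
Proof. by rewrite -clamp1E clamp_id// lexx ler01. Qed.

Lemma ival_continuous : continuous ival.
Proof. exact: initial_continuous. Qed.

Lemma clamp_continuous : continuous clamp.
Proof.
apply: (@continuous_comp_initial _ _ _ (set_val : `[0:R,1]%classic -> R)).
move=> t; apply: (@continuous_max R R (cst 0) (fun t => Num.min t 1)).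
  exact: cst_continuous.
apply: (@continuous_min R R idfun (cst 1)) => //.
exact: cst_continuous.
Qed.

Lemma cts_comp (A B C : topologicalType) (f : A -> B) (g : B -> C) :
  continuous f -> continuous g -> continuous (fun x => g (f x)).
Proof. by move=> cf cg x; apply: continuous_comp; [exact: cf | exact: cg]. Qed.

Lemma cts_cst (A B : topologicalType) (b : B) : continuous (fun _ : A => b).
Proof. by move=> x; exact: cvg_cst. Qed.

Lemma cts_pair (A B C : topologicalType) (f : A -> B) (g : A -> C) :
  continuous f -> continuous g -> continuous (fun x => (f x, g x)).
Proof. by move=> cf cg x; apply: cvg_pair; [exact: cf | exact: cg]. Qed.

Lemma cts_fst (A B C : topologicalType) (f : A -> C) :
  continuous f -> continuous (fun x : A * B => f x.1).
Proof.
move=> cf; apply: (@cts_comp _ _ _ fst f) => //.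
by move=> x; exact: cvg_fst.
Qed.

Lemma cts_snd (A B C : topologicalType) (f : B -> C) :
  continuous f -> continuous (fun x : A * B => f x.2).
Proof.
move=> cf; apply: (@cts_comp _ _ _ snd f) => //.
by move=> x; exact: cvg_snd.
Qed.

Lemma cts_clamp (A : topologicalType) (f : A -> R) :
  continuous f -> continuous (fun x => clamp (f x)).
Proof. by move=> cf; apply: (cts_comp cf); exact: clamp_continuous. Qed.

Lemma cts_affine (A : topologicalType) (a b : R) (f : A -> R) :
  continuous f -> continuous (fun x => a * f x + b).
Proof.
move=> cf x; apply: cvgD; last exact: cvg_cst.
by apply: cvgM; [exact: cvg_cst | exact: cf].
Qed.

Lemma cts_scale (A : topologicalType) (a : R) (f : A -> R) :
  continuous f -> continuous (fun x => a * f x).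
Proof. by move=> cf x; apply: cvgM; [exact: cvg_cst | exact: cf]. Qed.

Lemma cts_compl (A : topologicalType) (f : A -> R) :
  continuous f -> continuous (fun x => 1 - f x).
Proof.
move=> cf; rewrite (_ : (fun _ => _) = (fun x => -1 * f x + 1)).
  exact: cts_affine.
by apply/funext => x; rewrite mulN1r addrC.
Qed.

Lemma cts_min (A : topologicalType) (f g : A -> R) :
  continuous f -> continuous g -> continuous (fun x => Num.min (f x) (g x)).
Proof.
by move=> cf cg x; apply: (@continuous_min R _ f g); [exact: cf | exact: cg].
Qed.

Lemma cts_max (A : topologicalType) (f g : A -> R) :
  continuous f -> continuous g -> continuous (fun x => Num.max (f x) (g x)).
Proof.
by move=> cf cg x; apply: (@continuous_max R _ f g); [exact: cf | exact: cg].
Qed.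

Lemma paste (T X : topologicalType) (u : T -> R) (f g : T -> X) :
    continuous u -> continuous f -> continuous g ->
    (forall t, u t = 2^-1 -> f t = g t) ->
  continuous (fun t => if u t <= 2^-1 then f t else g t).
Proof.
move=> cu cf cg fg; apply/continuous_subspace_setT.
have -> : [set: T] = [set t | u t <= 2^-1] `|` [set t | 2^-1 <= u t].
  apply/esym/seteqP; split => // t _ /=.
  by case: (leP (u t) 2^-1) => [|/ltW]; [left|right].
apply: withinU_continuous.
- apply: (@preimage_closed _ _ u [set x | x <= 2^-1]); last exact: closed_le.
  by move=> x _; exact: cu.
- apply: (@preimage_closed _ _ u [set x | 2^-1 <= x]); last exact: closed_ge.
  by move=> x _; exact: cu.
- apply: (@subspace_eq_continuous _ _ _ f); last exact: continuous_subspaceT.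
  by move=> t; rewrite inE /= => ut; rewrite /from_subspace ut.
- apply: (@subspace_eq_continuous _ _ _ g); last exact: continuous_subspaceT.
  move=> t; rewrite inE /= => ut; rewrite /from_subspace; case: ifPn => // ut'; apply/esym/fg/le_anti.
  by rewrite ut' ut.
Qed.

End Interval.
Section Paths.
Variable R : realType.
Local Notation I := (unit_interval R).

Definition path_connected (X : topologicalType) : Prop :=
  forall x y : X, inhabited {path I from x to y}.

Section Operations.
Variable X : topologicalType.
Implicit Types x y z : X.

Definition path_const x : {path I from x to x} := cst x.

Lemma path_rev_continuous x y (p : {path I from x to y}) :
  continuous (fun t : I => p (clamp (1 - ival t))).
Proof.
apply: (cts_comp (g := p)); last exact: cts_fun.
apply/cts_clamp/cts_compl; exact: ival_continuous.
Qed.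

Lemma path_rev_zero x y (p : {path I from x to y}) :
  p (clamp (1 - ival zero)) = y.
Proof. by rewrite ival0 subr0 clamp1E path_one. Qed.

Lemma path_rev_one x y (p : {path I from x to y}) :
  p (clamp (1 - ival one)) = x.
Proof. by rewrite ival1 subrr clamp0E path_zero. Qed.

Definition path_rev x y (p : {path I from x to y}) : {path I from y to x} :=
  mk_path (@path_rev_continuous x y p) (path_rev_zero p) (path_rev_one p).

Lemma path_revE x y (p : {path I from x to y}) t :
  path_rev p t = p (clamp (1 - ival t)).
Proof. by []. Qed.

Definition path_cat_fun x y z (p : {path I from x to y})
    (q : {path I from y to z}) (t : I) : X :=
  if ival t <= 2^-1 then p (clamp (2 * ival t))
  else q (clamp (2 * ival t - 1)).

Lemma path_cat_continuous x y z (p : {path I from x to y})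
  (q : {path I from y to z}) : continuous (path_cat_fun p q).
Proof.
apply: paste; first exact: ival_continuous.
- apply: (cts_comp (g := p)); last exact: cts_fun.
  by apply: cts_clamp; apply: cts_scale; exact: ival_continuous.
- apply: (cts_comp (g := q)); last exact: cts_fun.
  by apply: cts_clamp; apply: cts_affine; exact: ival_continuous.
- move=> t ->; rewrite divff ?pnatr_eq0// subrr clamp0E clamp1E.
  by rewrite path_zero path_one.
Qed.

Lemma path_cat_zero x y z (p : {path I from x to y})
  (q : {path I from y to z}) : path_cat_fun p q zero = x.
Proof.
by rewrite /path_cat_fun ival0 invr_ge0 ler0n mulr0 clamp0E path_zero.
Qed.

Lemma path_cat_one x y z (p : {path I from x to y})
  (q : {path I from y to z}) : path_cat_fun p q one = z.
Proof.
rewrite /path_cat_fun ival1 ifN; last by rewrite -ltNge invf_lt1 ?ltr1n.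
by rewrite (_ : 2 * 1 - 1 = 1 :> R) ?clamp1E ?path_one//; lra.
Qed.

Definition path_cat x y z (p : {path I from x to y})
    (q : {path I from y to z}) : {path I from x to z} :=
  mk_path (@path_cat_continuous x y z p q) (path_cat_zero p q) (path_cat_one p q).

Lemma path_catE x y z (p : {path I from x to y}) (q : {path I from y to z}) t :
  path_cat p q t = if ival t <= 2^-1 then p (clamp (2 * ival t))
                   else q (clamp (2 * ival t - 1)).
Proof. by []. Qed.

Definition path_homotopic x y (p q : {path I from x to y}) : Prop :=
  exists H : I * I -> X,
    [/\ continuous H,
        forall t, H (t, zero) = p t,
        forall t, H (t, one) = q t,
        forall s, H (zero, s) = x &
        forall s, H (one, s) = y].

Lemma straight_homotopy (V : normedModType R) x y (k : V -> X) (u v : I -> V)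
    (p q : {path I from x to y}) :
    continuous k -> continuous u -> continuous v ->
    u zero = v zero -> u one = v one -> (forall t, p t = k (u t)) ->
    (forall t, q t = k (v t)) ->
  path_homotopic p q.
Proof.
move=> ck cu cv uv0 uv1 pE qE.
exists (fun ts => k ((1 - ival ts.2) *: u ts.1 + ival ts.2 *: v ts.1)); split.
- apply: (cts_comp (g := k)) => //.
  have ci := cts_snd (A := I) (@ival_continuous R).
  move=> ts; apply: cvgD; apply: cvgZ.
  + exact: cts_compl ci ts.
  + exact: cts_fst cu ts.
  + exact: ci.
  + exact: cts_fst cv ts.
- by move=> t /=; rewrite ival0 subr0 scale1r scale0r addr0 pE.
- by move=> t /=; rewrite ival1 subrr scale1r scale0r add0r qE.
- move=> s /=; rewrite -uv0 -scalerDl subrK scale1r -pE path_zero //.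
- move=> s /=; rewrite -uv1 -scalerDl subrK scale1r -pE path_one //.
Qed.

(* Two reparametrizations of one path are homotopic when they agree at the
   endpoints. *)
Lemma reparam_homotopy a b x y (c : {path I from a to b}) (u v : I -> R)
    (p q : {path I from x to y}) :
    continuous u -> continuous v -> u zero = v zero -> u one = v one ->
    (forall t, p t = c (clamp (u t))) -> (forall t, q t = c (clamp (v t))) ->
  path_homotopic p q.
Proof.
move=> cu cv uv0 uv1 pE qE.
apply: (@straight_homotopy (R^o : normedModType R) x y (c \o @clamp R) u v)
  => //.
apply: cts_comp; first exact: clamp_continuous.
exact: cts_fun.
Qed.

Lemma path_homotopic_refl x y (p : {path I from x to y}) : path_homotopic p p.
Proof.
apply: (@reparam_homotopy _ _ x y p (@ival R) (@ival R)) => //.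
- exact: ival_continuous.
- exact: ival_continuous.
- by move=> t; rewrite ivalK.
- by move=> t; rewrite ivalK.
Qed.

Lemma path_homotopic_sym x y (p q : {path I from x to y}) :
  path_homotopic p q -> path_homotopic q p.
Proof.
move=> [H [cH H0 H1 Hx Hy]].
exists (fun ts => H (ts.1, clamp (1 - ival ts.2))); split => //.
- apply: (cts_comp (g := H)) => //; apply: cts_pair.
    by move=> ts; exact: cvg_fst.
  by apply: cts_clamp; apply: cts_compl; apply: cts_snd; exact: ival_continuous.
- by move=> t; rewrite ival0 subr0 H1.
- by move=> t; rewrite ival1 subrr H0.
Qed.

Lemma path_homotopic_trans x y (q p r : {path I from x to y}) :
  path_homotopic p q -> path_homotopic q r -> path_homotopic p r.
Proof.
move=> [H [cH H0 H1 Hx Hy]] [K [cK K0 K1 Kx Ky]].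
exists (fun ts => if ival ts.2 <= 2^-1 then H (ts.1, clamp (2 * ival ts.2))
                  else K (ts.1, clamp (2 * ival ts.2 - 1))).
have ci := cts_snd (A := I) (@ival_continuous R).
split => //.
- apply: paste => //.
  + apply: (cts_comp (g := H)) => //; apply: cts_pair.
      by move=> ts; exact: cvg_fst.
    by apply: cts_clamp; apply: cts_scale.
  + apply: (cts_comp (g := K)) => //; apply: cts_pair.
      by move=> ts; exact: cvg_fst.
    by apply: cts_clamp; apply: cts_affine.
  + by move=> ts ->; rewrite divff ?pnatr_eq0// subrr clamp0E clamp1E H1 K0.
- by move=> t; rewrite ival0 invr_ge0 ler0n mulr0 clamp0E H0.
- move=> t; rewrite ival1 ifN; last by rewrite -ltNge invf_lt1 ?ltr1n.
  by rewrite (_ : 2 * 1 - 1 = 1 :> R) ?clamp1E ?K1//; lra.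
- by move=> s; case: ifP.
- by move=> s; case: ifP.
Qed.

Lemma path_cat_homotopic x y z (p p' : {path I from x to y})
    (q q' : {path I from y to z}) :
  path_homotopic p p' -> path_homotopic q q' ->
  path_homotopic (path_cat p q) (path_cat p' q').
Proof.
move=> [H [cH H0 H1 Hx Hy]] [K [cK K0 K1 Kx Ky]].
exists (fun ts => if ival ts.1 <= 2^-1 then H (clamp (2 * ival ts.1), ts.2)
                  else K (clamp (2 * ival ts.1 - 1), ts.2)).
have ci := cts_fst (B := I) (@ival_continuous R).
split => //.
- apply: paste => //.
  + apply: (cts_comp (g := H)) => //; apply: cts_pair.
      by apply: cts_clamp; apply: cts_scale.
    by move=> ts; exact: cvg_snd.
  + apply: (cts_comp (g := K)) => //; apply: cts_pair.
      by apply: cts_clamp; apply: cts_affine.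
    by move=> ts; exact: cvg_snd.
  + by move=> ts ->; rewrite divff ?pnatr_eq0// subrr clamp0E clamp1E Hy Kx.
- by move=> t; rewrite path_catE H0 K0.
- by move=> t; rewrite path_catE H1 K1.
- by move=> s; rewrite ival0 invr_ge0 ler0n mulr0 clamp0E.
- move=> s; rewrite ival1 ifN; last by rewrite -ltNge invf_lt1 ?ltr1n.
  by rewrite (_ : 2 * 1 - 1 = 1 :> R) ?clamp1E//; lra.
Qed.

Lemma path_rev_homotopic x y (p p' : {path I from x to y}) :
  path_homotopic p p' -> path_homotopic (path_rev p) (path_rev p').
Proof.
move=> [H [cH H0 H1 Hx Hy]].
exists (fun ts => H (clamp (1 - ival ts.1), ts.2)); split => //.
- apply: (cts_comp (g := H)) => //; apply: cts_pair.
    by apply: cts_clamp; apply: cts_compl; apply: cts_fst; exact: ival_continuous.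
  by move=> ts; exact: cvg_snd.
- by move=> t; rewrite path_revE H0.
- by move=> t; rewrite path_revE H1.
- by move=> s; rewrite ival0 subr0 clamp1E.
- by move=> s; rewrite ival1 subrr clamp0E.
Qed.

Lemma path_revK x y (p : {path I from x to y}) : path_rev (path_rev p) = p.
Proof.
apply/path_eqP => t; rewrite !path_revE clamp_id.
  by rewrite opprB addrC subrK ivalK.
by have := ival_ge0 t; have := ival_le1 t; lra.
Qed.

Lemma path_cat_const_l x y (p : {path I from x to y}) :
  path_homotopic (path_cat (path_const x) p) p.
Proof.
apply: (@reparam_homotopy _ _ x y p (fun t => Num.max 0 (2 * ival t + (-1)))
  (@ival R)).
- apply: cts_max; first exact: cts_cst.
  by apply: cts_affine; exact: ival_continuous.
- exact: ival_continuous.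
- by rewrite ival0 max_l //; lra.
- by rewrite ival1 max_r //; lra.
- move=> t; rewrite path_catE; case: ifPn => ht.
    by rewrite max_l ?clamp0E ?path_zero//; lra.
  by rewrite max_r//; rewrite -ltNge in ht; lra.
- by move=> t; rewrite ivalK.
Qed.

Lemma path_cat_const_r x y (p : {path I from x to y}) :
  path_homotopic (path_cat p (path_const y)) p.
Proof.
apply: (@reparam_homotopy _ _ x y p (fun t => Num.min (2 * ival t + 0) 1)
  (@ival R)).
- apply: cts_min; last exact: cts_cst.
  by apply: cts_affine; exact: ival_continuous.
- exact: ival_continuous.
- by rewrite ival0 min_l //; lra.
- by rewrite ival1 min_r //; lra.
- move=> t; rewrite path_catE addr0; case: ifPn => ht.
    by rewrite min_l//; lra.
  by rewrite min_r ?clamp1E ?path_one//; rewrite -ltNge in ht; lra.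
- by move=> t; rewrite ivalK.
Qed.

Lemma path_cat_rev_r x y (p : {path I from x to y}) :
  path_homotopic (path_cat p (path_rev p)) (path_const x).
Proof.
apply: (@reparam_homotopy _ _ x x p
  (fun t => Num.min (2 * ival t + 0) (-2 * ival t + 2)) (fun=> 0)).
- by apply: cts_min; apply: cts_affine; exact: ival_continuous.
- exact: cts_cst.
- by rewrite ival0 /= min_l; lra.
- by rewrite ival1 /= min_r; lra.
- move=> t; have := ival_ge0 t; have := ival_le1 t => t1 t0.
  rewrite path_catE addr0; case: ifPn => ht.
    by rewrite min_l//; lra.
  rewrite -ltNge in ht; rewrite path_revE min_r; last by lra.
  rewrite clamp_id; last by lra.
  by congr (p (clamp _)); lra.
- by move=> t; rewrite /= clamp0E path_zero.
Qed.

Lemma path_cat_rev_l x y (p : {path I from x to y}) :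
  path_homotopic (path_cat (path_rev p) p) (path_const y).
Proof. by have := path_cat_rev_r (path_rev p); rewrite path_revK. Qed.

Lemma path_catA w x y z (p : {path I from w to x}) (q : {path I from x to y})
    (r : {path I from y to z}) :
  path_homotopic (path_cat p (path_cat q r)) (path_cat (path_cat p q) r).
Proof.
apply: path_homotopic_sym.
apply: (@reparam_homotopy _ _ w z (path_cat p (path_cat q r))
  (fun t => Num.min (2 * ival t + 0)
              (Num.min (1 * ival t + 4^-1) (2^-1 * ival t + 2^-1))) (@ival R)).
- by do ?apply: cts_min; apply: cts_affine; exact: ival_continuous.
- exact: ival_continuous.
- by rewrite ival0 min_l // ?le_min; lra.
- by rewrite ival1 min_r // ?ge_min ?min_r; lra.
- move=> t; have := ival_ge0 t; have := ival_le1 t => t1 t0.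
  rewrite !path_catE.
  have [h2|h2] := lerP (ival t) 2^-1.
  + rewrite (@clamp_id _ (2 * ival t)); last by lra.
    have [h4|h4] := lerP (ival t) 4^-1.
    * rewrite min_l; last by rewrite le_min; lra.
      rewrite addr0 clamp_id; last by lra.
      by rewrite !ifT//; lra.
    * rewrite (@min_l _ _ (1 * ival t + 4^-1)); last by lra.
      rewrite min_r; last by lra.
      rewrite (@clamp_id _ (1 * ival t + 4^-1)); last by lra.
      rewrite ifN; last by rewrite -ltNge; lra.
      rewrite ifN; last by rewrite -ltNge; lra.
      rewrite (@clamp_id _ (2 * (1 * ival t + 4^-1) - 1)); last by lra.
      rewrite ifT; last by lra.
      by congr (q (clamp _)); lra.
  + rewrite (@min_r _ _ (1 * ival t + 4^-1)); last by lra.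
    rewrite min_r; last by lra.
    rewrite (@clamp_id _ (2^-1 * ival t + 2^-1)); last by lra.
    rewrite ifN; last by rewrite -ltNge; lra.
    rewrite (@clamp_id _ (2 * (2^-1 * ival t + 2^-1) - 1)); last by lra.
    rewrite ifN; last by rewrite -ltNge; lra.
    by congr (r (clamp _)); lra.
- by move=> t; rewrite ivalK.
Qed.

Lemma path_rev_cat x y z (p : {path I from x to y}) (q : {path I from y to z}) :
  path_rev (path_cat p q) = path_cat (path_rev q) (path_rev p).
Proof.
apply/path_eqP => t; have := ival_ge0 t; have := ival_le1 t => t1 t0.
rewrite path_revE !path_catE !path_revE.
rewrite (@clamp_id _ (1 - ival t)); last by lra.
have [h|h|h] := ltrgtP (ival t) 2^-1.
- rewrite ifN; last by rewrite -ltNge; lra.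
  by rewrite clamp_id; [congr (q (clamp _)); lra | lra].
- rewrite ifT; last by lra.
  by rewrite clamp_id; [congr (p (clamp _)); lra | lra].
- rewrite ifT; last by lra.
  rewrite h (_ : 2 * (1 - 2^-1) = 1 :> R); last by lra.
  rewrite (_ : 2 / 2 = 1 :> R); last by lra.
  by rewrite !clamp1E ival1 subrr clamp0E path_zero path_one.
Qed.

End Operations.
End Paths.

Section FundamentalGroup.
Variables (R : realType) (X : topologicalType) (x : X).
Local Notation I := (unit_interval R).

Definition loop_homotopic (p q : {path I from x to x}) : bool :=
  `[< path_homotopic p q >].

Lemma loop_homotopic_refl : reflexive loop_homotopic.
Proof. by move=> p; apply/asboolP; exact: path_homotopic_refl. Qed.

Lemma loop_homotopic_sym : symmetric loop_homotopic.
Proof.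
move=> p q; apply/asboolP/asboolP; exact: path_homotopic_sym.
Qed.

Lemma loop_homotopic_trans : transitive loop_homotopic.
Proof.
move=> q p r /asboolP pq /asboolP qr; apply/asboolP.
exact: path_homotopic_trans pq qr.
Qed.

Canonical loop_homotopic_equiv :=
  EquivRel loop_homotopic loop_homotopic_refl loop_homotopic_sym
    loop_homotopic_trans.

Definition pi1 : Type := {eq_quot loop_homotopic}.

HB.instance Definition _ := Choice.on pi1.
HB.instance Definition _ := EqQuotient.on pi1.

Definition pi1_class (p : {path I from x to x}) : pi1 := \pi_pi1 p.

Lemma pi1_classP (p q : {path I from x to x}) :
  pi1_class p = pi1_class q <-> path_homotopic p q.
Proof.
split=> [/eqP|pq]; first by rewrite /pi1_class piE => /asboolP.
by apply/eqP; rewrite /pi1_class piE; apply/asboolP.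
Qed.

Lemma pi1_reprK (a : pi1) : pi1_class (repr a) = a.
Proof. exact: reprK. Qed.

Lemma pi1_repr_class (p : {path I from x to x}) :
  path_homotopic (repr (pi1_class p)) p.
Proof. by apply/pi1_classP; rewrite pi1_reprK. Qed.

Definition pi1_one : pi1 := pi1_class (path_const R x).

(* [p] * [q] is the class of "first p, then q". *)
Definition pi1_mul (a b : pi1) : pi1 :=
  pi1_class (path_cat (repr a) (repr b)).

Definition pi1_inv (a : pi1) : pi1 := pi1_class (path_rev (repr a)).

Lemma pi1_mulE (p q : {path I from x to x}) :
  pi1_mul (pi1_class p) (pi1_class q) = pi1_class (path_cat p q).
Proof. by apply/pi1_classP; apply: path_cat_homotopic; exact: pi1_repr_class. Qed.

Lemma pi1_invE (p : {path I from x to x}) :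
  pi1_inv (pi1_class p) = pi1_class (path_rev p).
Proof. by apply/pi1_classP; apply: path_rev_homotopic; exact: pi1_repr_class. Qed.

Lemma pi1_mulA : associative pi1_mul.
Proof.
move=> a b c; rewrite -(pi1_reprK a) -(pi1_reprK b) -(pi1_reprK c) !pi1_mulE.
by apply/pi1_classP; exact: path_catA.
Qed.

Lemma pi1_mul1 : left_id pi1_one pi1_mul.
Proof.
move=> a; rewrite -(pi1_reprK a) pi1_mulE.
by apply/pi1_classP; exact: path_cat_const_l.
Qed.

Lemma pi1_mulr1 : right_id pi1_one pi1_mul.
Proof.
move=> a; rewrite -(pi1_reprK a) pi1_mulE.
by apply/pi1_classP; exact: path_cat_const_r.
Qed.

Lemma pi1_mulV : left_inverse pi1_one pi1_inv pi1_mul.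
Proof.
move=> a; rewrite -(pi1_reprK a) pi1_invE pi1_mulE.
by apply/pi1_classP; exact: path_cat_rev_l.
Qed.

Lemma pi1_mulrV : right_inverse pi1_one pi1_inv pi1_mul.
Proof.
move=> a; rewrite -(pi1_reprK a) pi1_invE pi1_mulE.
by apply/pi1_classP; exact: path_cat_rev_r.
Qed.

HB.instance Definition _ := isGroup.Build pi1
  pi1_mulA pi1_mul1 pi1_mulr1 pi1_mulV pi1_mulrV.

End FundamentalGroup.

Record based_map (X : topologicalType) (x : X) (Y : topologicalType) (y : Y) :=
  BasedMap {
    based_fun :> continuousType X Y;
    based_funE : based_fun x = y }.

Lemma based_map_eq (X : topologicalType) (x : X) (Y : topologicalType) (y : Y)
  (f g : based_map x y) : f =1 g -> f = g.
Proof.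
case: f g => [f fE] [g gE] /= /continuousEP fg.
by subst g; rewrite (Prop_irrelevance fE gE).
Qed.

Section InducedHomomorphism.
Variables (R : realType) (X : topologicalType) (x : X).
Variables (Y : topologicalType) (y : Y) (f : based_map x y).
Local Notation I := (unit_interval R).

Lemma loop_map_continuous (p : {path I from x to x}) : continuous (f \o p).
Proof. exact: (cts_comp (@cts_fun _ _ p) (@cts_fun _ _ f)). Qed.

Lemma loop_map_zero (p : {path I from x to x}) : (f \o p) zero = y.
Proof. by rewrite /= path_zero based_funE. Qed.

Lemma loop_map_one (p : {path I from x to x}) : (f \o p) one = y.
Proof. by rewrite /= path_one based_funE. Qed.

Definition loop_map (p : {path I from x to x}) : {path I from y to y} :=
  mk_path (@loop_map_continuous p) (loop_map_zero p) (loop_map_one p).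

Lemma loop_mapE (p : {path I from x to x}) t : loop_map p t = f (p t).
Proof. by []. Qed.

Lemma loop_map_homotopic (p q : {path I from x to x}) :
  path_homotopic p q -> path_homotopic (loop_map p) (loop_map q).
Proof.
move=> [H [cH H0 H1 Hx Hy]]; exists (f \o H); split => /=.
- exact: (cts_comp cH (@cts_fun _ _ f)).
- by move=> t; rewrite H0.
- by move=> t; rewrite H1.
- by move=> t; rewrite Hx based_funE.
- by move=> t; rewrite Hy based_funE.
Qed.

Definition pi1_map (a : pi1 R x) : pi1 R y := pi1_class (loop_map (repr a)).

Lemma pi1_mapE (p : {path I from x to x}) :
  pi1_map (pi1_class p) = pi1_class (loop_map p).
Proof. by apply/pi1_classP; apply: loop_map_homotopic; exact: pi1_repr_class. Qed.

Lemma pi1_mapM (a b : pi1 R x) : pi1_map (a * b)%g = (pi1_map a * pi1_map b)%g.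
Proof.
rewrite -(pi1_reprK a) -(pi1_reprK b) [(_ * _)%g]pi1_mulE !pi1_mapE.
rewrite [RHS]pi1_mulE; congr pi1_class; apply/path_eqP => t.
by rewrite !(loop_mapE, path_catE); case: ifP.
Qed.

Lemma pi1_map1 : pi1_map 1%g = 1%g.
Proof.
rewrite [1%g in LHS]/(pi1_one R x) pi1_mapE; congr pi1_class.
by apply/path_eqP => t; rewrite loop_mapE /= based_funE.
Qed.

HB.instance Definition _ := isMultiplicative.Build _ _ pi1_map pi1_mapM.
HB.instance Definition _ := Multiplicative_isUMagmaMorphism.Build _ _ pi1_map
  pi1_map1.

End InducedHomomorphism.

(* [C] is the class of objects of a full subcategory.  [BasedMap (erefl (p e))]
   is p as a based map (E, e) -> (X, p e), so the two ranges are the images of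
   the fundamental groups under f_* and p_*. *)
Definition is_covering (R : realType) (C : topologicalType -> Prop)
    (E X : topologicalType) (p : continuousType E X) : Prop :=
  C E /\
  forall Y : topologicalType, C Y ->
  forall (e : E) (y : Y) (f : based_map y (p e)),
    range (pi1_map (R := R) f) `<=`
      range (pi1_map (R := R) (BasedMap (erefl (p e)))) ->
    exists! g : based_map y e, p \o g = f :> (Y -> X).

Section Lifting.
Variables (R : realType) (C : topologicalType -> Prop).
Hypothesis C_disk : C (disk R).
Variables (E X : topologicalType) (p : continuousType E X).
Hypothesis p_cov : is_covering R C p.
Local Notation I := (unit_interval R).

Lemma square_to_disk_subproof (s : I * I) :
  (2^-1 * ival s.1, 2^-1 * ival s.2) \in
    [set z : R * R | z.1 ^+ 2 + z.2 ^+ 2 <= 1].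
Proof.
rewrite inE /=.
have := ival_ge0 s.1; have := ival_le1 s.1.
have := ival_ge0 s.2; have := ival_le1 s.2.
by move=> *; nra.
Qed.

Definition square_to_disk (s : I * I) : disk R :=
  SigSub (square_to_disk_subproof s).

Definition disk_to_square (z : disk R) : I * I :=
  (clamp (2 * (set_val z).1), clamp (2 * (set_val z).2)).

Lemma square_to_diskK : cancel square_to_disk disk_to_square.
Proof.
move=> [s t]; rewrite /disk_to_square /= !mulrA divff ?pnatr_eq0//.
by rewrite !mul1r !ivalK.
Qed.

Let disk_val_continuous : continuous (set_val : disk R -> R * R).
Proof. exact: initial_continuous. Qed.

Lemma square_to_disk_continuous : continuous square_to_disk.
Proof.
apply: (@continuous_comp_initial _ _ _ (set_val : disk R -> R * R)).
apply: (@cts_pair (I * I)%type R R (fun s => 2^-1 * ival s.1)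
  (fun s => 2^-1 * ival s.2)).
- by apply: cts_scale; apply: cts_fst; exact: ival_continuous.
- by apply: cts_scale; apply: cts_snd; exact: ival_continuous.
Qed.

Let disk_coord_continuous :
  continuous (fun z : disk R => 2 * (set_val z).1) /\
  continuous (fun z : disk R => 2 * (set_val z).2).
Proof.
split; apply: cts_scale; apply: (cts_comp disk_val_continuous).
  by move=> ?; exact: cvg_fst.
by move=> ?; exact: cvg_snd.
Qed.

Lemma disk_to_square_continuous : continuous disk_to_square.
Proof.
have [c1 c2] := disk_coord_continuous.
by apply: cts_pair; exact: cts_clamp.
Qed.

Lemma disk_to_square_center : disk_to_square (square_to_disk (zero, zero)) =
  (zero, zero).
Proof. exact: square_to_diskK. Qed.

Lemma square_lift (k : I * I -> X) (e : E) :
    continuous k -> k (zero, zero) = p e ->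
  exists L : continuousType (I * I)%type E, L (zero, zero) = e /\ p \o L = k.
Proof.
move=> ck k0.
pose o := square_to_disk (zero, zero).
have cf : continuous (k \o disk_to_square).
  exact: (cts_comp disk_to_square_continuous ck).
have f0 : (k \o disk_to_square) o = p e.
  by rewrite /= disk_to_square_center.
pose f : based_map o (p e) :=
  @BasedMap _ o _ (p e) (mkcts cf) f0.
have [|g [gf _]] := p_cov.2 _ C_disk e o f.
  move=> _ [a _ <-]; exists 1%g => //; rewrite [LHS]pi1_map1.
  rewrite -(pi1_reprK a) pi1_mapE; apply/pi1_classP/path_homotopic_sym.
  have [c1 c2] := disk_coord_continuous.
  apply: (@straight_homotopy R X ((R^o * R^o)%type : normedModType R) _ _
    (fun v => k (clamp v.1, clamp v.2))
    (fun t => (2 * (set_val (repr a t)).1, 2 * (set_val (repr a t)).2))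
    (fun=> (0, 0))).
  - apply: (cts_comp (g := k)) => //.
    by apply: cts_pair; apply: cts_clamp; move=> ?;
      [exact: cvg_fst | exact: cvg_snd].
  - by apply: cts_pair; [apply: (cts_comp _ c1) | apply: (cts_comp _ c2)];
      exact: cts_fun.
  - exact: cts_cst.
  - by rewrite path_zero /= ival0 !mulr0.
  - by rewrite path_one /= ival0 !mulr0.
  - by move=> t; rewrite loop_mapE.
  - by move=> t; rewrite /= -k0 !clamp0E.
have cL : continuous (g \o square_to_disk).
  exact: (cts_comp square_to_disk_continuous (@cts_fun _ _ g)).
exists (mkcts cL : continuousType _ _); split.
  exact: (based_funE g).
apply/funext => s; rewrite /= /mkcts /=.
have := congr1 (fun h => h (square_to_disk s)) gf.
by rewrite /= /mkcts /= square_to_diskK.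
Qed.

Lemma square_lift_unique (L M : I * I -> E) :
    continuous L -> continuous M -> L (zero, zero) = M (zero, zero) ->
    p \o L = p \o M ->
  L = M.
Proof.
move=> cL cM LM0 pLM.
pose o := square_to_disk (zero, zero).
pose e := L (zero, zero).
have cLd : continuous (L \o disk_to_square).
  exact: (cts_comp disk_to_square_continuous cL).
have cMd : continuous (M \o disk_to_square).
  exact: (cts_comp disk_to_square_continuous cM).
have Ld0 : (L \o disk_to_square) o = e by rewrite /= disk_to_square_center.
have Md0 : (M \o disk_to_square) o = e by rewrite /= disk_to_square_center.
pose gL : based_map o e := @BasedMap _ o _ e (mkcts cLd) Ld0.
pose gM : based_map o e := @BasedMap _ o _ e (mkcts cMd) Md0.
have pg0 : (p \o gL) o = p e by rewrite /= /mkcts Ld0.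
pose f : based_map o (p e) := @BasedMap _ o _ (p e) (p \o gL) pg0.
have [|g [_ gU]] := p_cov.2 _ C_disk e o f.
  move=> _ [a _ <-]; exists (pi1_map gL a) => //.
  rewrite -(pi1_reprK a) !pi1_mapE; congr pi1_class.
  exact/path_eqP.
have : gL = gM.
  rewrite -(gU gL) // -(gU gM) //.
  apply/funext => z /=; rewrite /mkcts /=.
  by have := congr1 (fun h => h (disk_to_square z)) pLM.
move=> gLM; apply/funext => s.
have := congr1 (fun h : based_map o e => h (square_to_disk s)) gLM.
by rewrite /= /mkcts /= square_to_diskK.
Qed.

Lemma path_lift_exists (x y : X) (a : {path I from x to y}) (e : E) :
    p e = x ->
  exists L : continuousType I E, L zero = e /\ p \o L = a.
Proof.
move=> pe.
have [||L [L0 pL]] := @square_lift (a \o fst) e.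
- by apply: (cts_comp (f := fst)) => [?|]; [exact: cvg_fst | exact: cts_fun].
- by rewrite /= path_zero.
have cL : continuous (fun t : I => L (t, zero)).
  apply: (cts_comp (g := L)); last exact: cts_fun.
  by apply: cts_pair; [move=> ?; exact: cvg_id | exact: cts_cst].
exists (mkcts cL : continuousType _ _); split=> //.
apply/funext => t; have := congr1 (fun h => h (t, zero)) pL.
by rewrite /= /mkcts.
Qed.

Lemma path_lift_unique (L M : continuousType I E) :
  L zero = M zero -> p \o L = p \o M -> L = M.
Proof.
move=> LM0 pLM; apply/continuousEP => t.
have LM : L \o fst = M \o fst :> (I * I -> E).
  apply: square_lift_unique => //.
  - by apply: cts_fst; exact: cts_fun.
  - by apply: cts_fst; exact: cts_fun.
  - by apply/funext => s; have := congr1 (fun h => h s.1) pLM.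
exact: (congr1 (fun h : I * I -> E => h (t, zero)) LM).
Qed.

Definition path_lift (x y : X) (a : {path I from x to y}) (e : E)
    (pe : p e = x) : continuousType I E :=
  projT1 (cid (path_lift_exists a pe)).

Lemma path_lift_zero (x y : X) (a : {path I from x to y}) (e : E)
  (pe : p e = x) : path_lift a pe zero = e.
Proof. by rewrite /path_lift; case: cid => L []. Qed.

Lemma path_liftK (x y : X) (a : {path I from x to y}) (e : E)
  (pe : p e = x) t : p (path_lift a pe t) = a t.
Proof. by rewrite /path_lift; case: cid => L [/= _ <-]. Qed.

Lemma path_lift_one (x y : X) (a : {path I from x to y}) (e : E)
  (pe : p e = x) : p (path_lift a pe one) = y.
Proof. by rewrite path_liftK path_one. Qed.

Lemma path_lift_eq (x y : X) (a : {path I from x to y}) (e : E)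
    (pe : p e = x) (L : continuousType I E) :
  L zero = e -> (forall t, p (L t) = a t) -> path_lift a pe = L.
Proof.
move=> L0 pL; apply: path_lift_unique; first by rewrite path_lift_zero.
by apply/funext => t /=; rewrite path_liftK pL.
Qed.

Lemma path_lift_start (x y : X) (a : {path I from x to y}) (e e' : E)
  (pe : p e = x) (pe' : p e' = x) (t : I) :
  e = e' -> path_lift a pe t = path_lift a pe' t.
Proof. by move=> ee'; subst e'; rewrite (Prop_irrelevance pe pe'). Qed.

Lemma path_lift_homotopic (x y : X) (a b : {path I from x to y}) (e : E)
    (pe : p e = x) :
  path_homotopic a b -> path_lift a pe one = path_lift b pe one.
Proof.
move=> [H [cH H0 H1 Hx Hy]].
have [|L [L0 pL]] := square_lift (e := e) cH; first by rewrite Hx.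
have pLE s : p (L s) = H s by rewrite -pL.
have c1 (s : I) : continuous (fun t : I => L (t, s)).
  apply: (cts_comp (g := L)); last exact: cts_fun.
  by apply: cts_pair; [move=> ?; exact: cvg_id | exact: cts_cst].
have c2 (t : I) : continuous (fun s : I => L (t, s)).
  apply: (cts_comp (g := L)); last exact: cts_fun.
  by apply: cts_pair; [exact: cts_cst | move=> ?; exact: cvg_id].
have cst_lift (t : I) (z : X) : (forall s, H (t, s) = z) ->
    L (t, zero) = L (t, one).
  move=> Hz.
  have LE : mkcts (c2 t) = cst (L (t, zero)) :> continuousType I E.
    apply: path_lift_unique => //.
    by apply/funext => s; rewrite /= /mkcts !pLE !Hz.
  exact: esym (congr1 (fun h : continuousType I E => h one) LE).
rewrite (@path_lift_eq _ _ a e pe (mkcts (c1 zero))) //; last first.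
  by move=> t; rewrite /= /mkcts pLE H0.
rewrite (@path_lift_eq _ _ b e pe (mkcts (c1 one))) /= /mkcts.
- exact: cst_lift Hy.
- by rewrite -(cst_lift _ _ Hx).
- by move=> t; rewrite pLE H1.
Qed.

Lemma path_lift_cat (x y z : X) (a : {path I from x to y})
    (b : {path I from y to z}) (e : E) (pe : p e = x) :
  path_lift (path_cat a b) pe one = path_lift b (path_lift_one a pe) one.
Proof.
pose L : {path I from e to path_lift a pe one} :=
  mk_path (@cts_fun _ _ (path_lift a pe)) (path_lift_zero a pe) erefl.
pose M : {path I from path_lift a pe one
               to path_lift b (path_lift_one a pe) one} :=
  mk_path (@cts_fun _ _ (path_lift b (path_lift_one a pe)))
    (path_lift_zero b (path_lift_one a pe)) erefl.
rewrite (@path_lift_eq _ _ (path_cat a b) e pe (path_cat L M)).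
- exact: path_one.
- exact: path_zero.
- by move=> t; rewrite [_ t](path_catE L M) path_catE; case: ifP => _; rewrite path_liftK.
Qed.

End Lifting.

Record category := Category {
  obj :> Type;
  hom : obj -> obj -> Type;
  idm : forall a, hom a a;
  compm : forall a b c, hom b c -> hom a b -> hom a c;
  comp1m : forall a b (f : hom a b), compm (idm b) f = f;
  compm1 : forall a b (f : hom a b), compm f (idm a) = f;
  compmA : forall a b c d (h : hom c d) (g : hom b c) (f : hom a b),
    compm h (compm g f) = compm (compm h g) f }.

Record functor (A B : category) := Functor {
  fobj :> A -> B;
  fhom : forall a b : A, hom a b -> hom (fobj a) (fobj b);
  fhom1 : forall a : A, fhom (idm a) = idm (fobj a);
  fhomM : forall (a b c : A) (g : hom b c) (f : hom a b),
    fhom (compm g f) = compm (fhom g) (fhom f) }.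

Definition fully_faithful (A B : category) (F : functor A B) : Prop :=
  forall a b : A, bijective (fhom F (a := a) (b := b)).

Section GSetCategory.
Variable G : groupType.

Record gset := GSet {
  gset_carrier :> Type;
  gact : G -> gset_carrier -> gset_carrier;
  gact1 : forall s, gact 1%g s = s;
  gactM : forall g h s, gact (g * h)%g s = gact g (gact h s) }.

Record gmap (S T : gset) := GMap {
  gmap_fun :> S -> T;
  gmapE : forall g s, gmap_fun (gact g s) = gact g (gmap_fun s) }.

Lemma gmap_eq (S T : gset) (f g : gmap S T) : f =1 g -> f = g.
Proof.
case: f g => [f fE] [g gE] /= /funext fg; subst g.
by rewrite (Prop_irrelevance fE gE).
Qed.

Definition gmap_id (S : gset) : gmap S S := @GMap S S id (fun _ _ => erefl).

Lemma gmap_comp_subproof (S T U : gset) (g : gmap T U) (f : gmap S T) x s :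
  (g \o f) (gact x s) = gact x ((g \o f) s).
Proof. by rewrite /= !gmapE. Qed.

Definition gmap_comp (S T U : gset) (g : gmap T U) (f : gmap S T) : gmap S U :=
  GMap (gmap_comp_subproof g f).

Lemma gmap_comp1m (S T : gset) (f : gmap S T) : gmap_comp (gmap_id T) f = f.
Proof. exact: gmap_eq. Qed.

Lemma gmap_compm1 (S T : gset) (f : gmap S T) : gmap_comp f (gmap_id S) = f.
Proof. exact: gmap_eq. Qed.

Lemma gmap_compmA (S T U V : gset) (h : gmap U V) (g : gmap T U)
  (f : gmap S T) : gmap_comp h (gmap_comp g f) = gmap_comp (gmap_comp h g) f.
Proof. exact: gmap_eq. Qed.

Definition GSetCat : category :=
  Category gmap_comp1m gmap_compm1 gmap_compmA.

End GSetCategory.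

Section CovCategory.
Variables (R : realType) (C : topologicalType -> Prop) (X : topologicalType).

Record covering := Covering {
  cov_space : topologicalType;
  cov_map :> continuousType cov_space X;
  cov_prop : is_covering R C cov_map }.

Record cov_mor (p q : covering) := CovMor {
  cov_mor_fun :> continuousType (cov_space p) (cov_space q);
  cov_morE : q \o cov_mor_fun = p :> (cov_space p -> X) }.

Lemma cov_mor_eq (p q : covering) (f g : cov_mor p q) : f =1 g -> f = g.
Proof.
case: f g => [f fE] [g gE] /= /continuousEP fg; subst g.
by rewrite (Prop_irrelevance fE gE).
Qed.

Definition cov_id (p : covering) : cov_mor p p :=
  @CovMor p p idfun erefl.

Lemma cov_comp_subproof (p q r : covering) (g : cov_mor q r) (f : cov_mor p q) :
  r \o (g \o f) = p :> (cov_space p -> X).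
Proof. by rewrite compA cov_morE cov_morE. Qed.

Definition cov_comp (p q r : covering) (g : cov_mor q r) (f : cov_mor p q) :
  cov_mor p r := @CovMor p r (g \o f) (cov_comp_subproof g f).

Lemma cov_comp1m (p q : covering) (f : cov_mor p q) : cov_comp (cov_id q) f = f.
Proof. exact: cov_mor_eq. Qed.

Lemma cov_compm1 (p q : covering) (f : cov_mor p q) : cov_comp f (cov_id p) = f.
Proof. exact: cov_mor_eq. Qed.

Lemma cov_compmA (p q r s : covering) (h : cov_mor r s) (g : cov_mor q r)
  (f : cov_mor p q) : cov_comp h (cov_comp g f) = cov_comp (cov_comp h g) f.
Proof. exact: cov_mor_eq. Qed.

Definition CovCat : category := Category cov_comp1m cov_compm1 cov_compmA.

End CovCategory.

Section Monodromy.
Variables (R : realType) (C : topologicalType -> Prop).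
Hypothesis C_disk : C (disk R).
Variables (X : topologicalType) (x0 : X).
Local Notation I := (unit_interval R).

Definition fiber (p : covering R C X) : Type :=
  set_type ((p : _ -> X) @^-1` [set x0]).

Lemma fiberP (p : covering R C X) (e : fiber p) : p (set_val e) = x0.
Proof. exact: (set_mem (valP e)). Qed.

Definition Fiber (p : covering R C X) (e : cov_space p) (pe : p e = x0) :
  fiber p := SigSub (mem_set pe : e \in (p : _ -> X) @^-1` [set x0]).

(* The class of a loop acts by the endpoint of the lift of the reversed loop,
   which makes this a left action; it does not depend on the representative
   [repr a], see [monodromy_actE]. *)
Definition monodromy_act (p : covering R C X) (a : pi1 R x0) (e : fiber p) :
    fiber p :=
  Fiber (path_lift_one C_disk (cov_prop p) (path_rev (repr a)) (fiberP e)).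

Lemma monodromy_actE (p : covering R C X) (a : {path I from x0 to x0})
    (e : fiber p) :
  set_val (monodromy_act (pi1_class a) e) =
  path_lift C_disk (cov_prop p) (path_rev a) (fiberP e) one.
Proof.
by apply: path_lift_homotopic; apply: path_rev_homotopic; exact: pi1_repr_class.
Qed.

Lemma monodromy_act1 (p : covering R C X) (e : fiber p) :
  monodromy_act 1%g e = e.
Proof.
apply: val_inj; rewrite [LHS]monodromy_actE.
rewrite (@path_lift_eq _ _ C_disk _ _ _ _ _ _ _ _ _ (cst (set_val e))) //.
by move=> t; rewrite /= fiberP.
Qed.

Lemma monodromy_actM (p : covering R C X) (a b : pi1 R x0) (e : fiber p) :
  monodromy_act (a * b)%g e = monodromy_act a (monodromy_act b e).
Proof.
rewrite -(pi1_reprK a) -(pi1_reprK b) [(_ * _)%g]pi1_mulE.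
apply: val_inj; rewrite [LHS]monodromy_actE [RHS]monodromy_actE.
rewrite path_rev_cat path_lift_cat.
apply: path_lift_start.
by apply/esym; exact: monodromy_actE.
Qed.

Definition monodromy_gset (p : covering R C X) : gset (pi1 R x0) :=
  GSet (@monodromy_act1 p) (@monodromy_actM p).

Lemma fiber_map_subproof (p q : covering R C X) (f : cov_mor p q)
  (e : fiber p) : q (f (set_val e)) = x0.
Proof.
by have := congr1 (fun h => h (set_val e)) (cov_morE f); rewrite /= fiberP.
Qed.

Definition fiber_map (p q : covering R C X) (f : cov_mor p q) (e : fiber p) :
  fiber q := Fiber (fiber_map_subproof f e).

Lemma fiber_map_equivariant (p q : covering R C X) (f : cov_mor p q)
    (a : pi1 R x0) (e : fiber p) :
  fiber_map f (monodromy_act a e) = monodromy_act a (fiber_map f e).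
Proof.
apply: val_inj; apply/esym.
rewrite /= (@path_lift_eq _ _ C_disk _ _ _ _ _ _ _ _ _
  (f \o path_lift C_disk (cov_prop p) (path_rev (repr a)) (fiberP e))) //.
  by rewrite /= path_lift_zero.
move=> t /=.
have := congr1 (fun h => h (path_lift C_disk (cov_prop p) (path_rev (repr a))
  (fiberP e) t)) (cov_morE f).
by rewrite /= path_liftK.
Qed.

Definition monodromy_gmap (p q : covering R C X) (f : cov_mor p q) :
  gmap (monodromy_gset p) (monodromy_gset q) :=
  @GMap _ (monodromy_gset p) (monodromy_gset q) (fiber_map f)
    (fiber_map_equivariant f).

Lemma monodromy_gmap1 (p : covering R C X) :
  monodromy_gmap (cov_id p) = gmap_id (monodromy_gset p).
Proof. by apply: gmap_eq => e; exact: val_inj. Qed.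

Lemma monodromy_gmapM (p q r : covering R C X) (g : cov_mor q r)
    (f : cov_mor p q) :
  monodromy_gmap (cov_comp g f) =
  gmap_comp (monodromy_gmap g) (monodromy_gmap f).
Proof. by apply: gmap_eq => e; exact: val_inj. Qed.

Definition monodromy : functor (CovCat R C X) (GSetCat (pi1 R x0)) :=
  @Functor (CovCat R C X) (GSetCat (pi1 R x0)) monodromy_gset monodromy_gmap
    monodromy_gmap1 monodromy_gmapM.

End Monodromy.

(* Main.v *)
Require Import Defs.
From mathcomp Require Import all_boot all_order all_algebra.
From mathcomp Require Import all_classical reals topology.
From mathcomp Require Import generic_quotient homotopy.
Local Open Scope classical_set_scope.

(* A lift of p along q is determined on any path by its value at the start of
   the path, so on a path-connected total space a morphism is determined by its
   value at one point of the fiber; this gives faithfulness.  For fullness, let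
   phi be equivariant and e0 a point of the fiber of p.  The stabilizer of e0 is
   p_*(pi_1(E, e0)), and equivariance puts it in the stabilizer of phi(e0), which
   is q_*(pi_1(E', phi(e0))); hence p lifts along q to a morphism sending e0 to
   phi(e0).  The action on the fiber of p is transitive, so this morphism
   restricts to phi. *)

Section Monodromy.
Set Implicit Arguments.
Unset Strict Implicit.
Variables (R : realType) (C : topologicalType -> Prop).
Hypothesis C_connected : forall Y : topologicalType,
  C Y -> [set: Y] !=set0 /\ path_connected R Y.
Hypothesis C_disk : C (disk R).
Variables (X : topologicalType) (x0 : X).
Local Notation I := (unit_interval R).
Local Notation act p := (@monodromy_act R C C_disk X x0 p).
Local Notation cov := (covering R C X).

Lemma cov_mor_fiber (p q : cov) (f : cov_mor p q) e : q (f e) = p e.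
Proof. exact: (congr1 (fun h => h e) (cov_morE f)). Qed.

(** The action lifts reversed loops, so acting by the class of [path_rev a] lifts [a] itself, and by
    uniqueness any lift [L] may replace the chosen [path_lift]. *)
Lemma monodromy_act_lift (p : cov) (a : {path I from x0 to x0})
    (e : fiber x0 p) (L : continuousType I (cov_space p)) :
    L zero = set_val e -> (forall t, p (L t) = a t) ->
  set_val (act p (pi1_class (path_rev a)) e) = L one.
Proof.
move=> L0 pL; rewrite monodromy_actE path_revK.
by rewrite (path_lift_eq C_disk (cov_prop p) (fiberP e) L0 pL).
Qed.

(** A path from [e] to [e'] is itself a lift of its image under [p], a loop at [x0]. *)
Lemma monodromy_transitive (p : cov) (e e' : fiber x0 p) :
  exists a, act p a e = e'.
Proof.
have [_ /(_ (set_val e) (set_val e'))[c]] := C_connected (cov_prop p).1.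
have cpc : continuous (p \o c).
  exact: (cts_comp (@cts_fun _ _ c) (@cts_fun _ _ p)).
have pc0 : (p \o c) zero = x0 by rewrite /= path_zero fiberP.
have pc1 : (p \o c) one = x0 by rewrite /= path_one fiberP.
exists (pi1_class (path_rev (mk_path cpc pc0 pc1))); apply: val_inj.
rewrite [LHS](monodromy_act_lift (L := c)) //; first exact: path_one.
exact: path_zero.
Qed.

Lemma fiber_nonempty (X_connected : path_connected R X) (p : cov) :
  inhabited (fiber x0 p).
Proof.
have [[e _] _] := C_connected (cov_prop p).1.
have [a] := X_connected (p e) x0.
by exists; exact: (Fiber (path_lift_one C_disk (cov_prop p) a erefl)).
Qed.

Lemma cov_mor_determined (p q : cov) (f g : cov_mor p q) (e : cov_space p) :
  f e = g e -> f = g.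
Proof.
move=> fge; apply: cov_mor_eq => e'.
have [_ /(_ e e')[c]] := C_connected (cov_prop p).1.
have fgc : f \o c = g \o c :> continuousType I (cov_space q).
  apply: (path_lift_unique C_disk (cov_prop q)).
    by rewrite /= path_zero.
  by apply/funext => t /=; rewrite !cov_mor_fiber.
have := congr1 (fun h : continuousType I (cov_space q) => h one) fgc.
by rewrite /= path_one.
Qed.

Lemma stabilizer_incl_lift (p q : cov) (e : fiber x0 p) (e' : fiber x0 q) :
    (forall a, act p a e = e -> act q a e' = e') ->
  exists f : cov_mor p q, f (set_val e) = set_val e'.
Proof.
move=> stab.
have pq : p (set_val e) = q (set_val e') by rewrite !fiberP.
(* The total space of [p] lies in [C], so it can be the test space in the lifting property of
   [q]. *)
have [|g [qg _]] := (cov_prop q).2 _ (cov_prop p).1 (set_val e') (set_val e)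
    (BasedMap pq); last first.
  by exists (@CovMor _ _ _ p q g qg); exact: based_funE.
move=> _ [a _ <-]; rewrite -(pi1_reprK a); set c := repr a.
(* This is [p \o c] seen as a loop at [x0], so that classes of loops can act on the fibers. It lifts
   along [p] to the loop [c], hence the class of its reverse fixes [e]. *)
pose l := loop_map (BasedMap (fiberP e)) c.
have /stab/(congr1 set_val) : act p (pi1_class (path_rev l)) e = e.
  apply: val_inj.
  rewrite [LHS](monodromy_act_lift (L := c)) //; first exact: path_one.
  exact: path_zero.
pose L := path_lift C_disk (cov_prop q) l (fiberP e').
have L0 : L zero = set_val e' by exact: path_lift_zero.
have qL t : q (L t) = l t by exact: path_liftK.
(* Fixing [e'] means that the lift [L] along [q] closes up, so its class is the required
   preimage. *)
rewrite (monodromy_act_lift (L := L)) // => L1.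
exists (pi1_class (mk_path (@cts_fun _ _ L) L0 L1)) => //.
by rewrite !pi1_mapE; congr pi1_class; apply/path_eqP => t; exact: qL.
Qed.

End Monodromy.

Theorem theorem8 (R : realType) (C : topologicalType -> Prop)
  (C_connected : forall Y : topologicalType,
     C Y -> [set: Y] !=set0 /\ path_connected R Y)
  (C_disk : C (disk R))
  (X : topologicalType) (X_connected : path_connected R X) (x0 : X) :
  fully_faithful (monodromy C_disk x0 : functor (CovCat R C X) (GSetCat (pi1 R x0))).
Proof.
move=> p q; have [e] := fiber_nonempty C_connected C_disk x0 X_connected p.
rewrite -setTT_bijective; split=> // [f g _ _ fg|phi _].
  apply: (cov_mor_determined C_connected C_disk (e := set_val e)).
  pose s : monodromy_gset C_disk x0 p := e.
  by have /(congr1 set_val) := congr1 (fun h : gmap _ _ => gmap_fun h s) fg.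
have [a ae|f fe] := stabilizer_incl_lift (C_disk := C_disk) (e := e) (e' := phi e).
  by have := gmapE phi a e; rewrite /= ae => <-.
exists f => //; apply: gmap_eq => e'.
have [a <-] := monodromy_transitive C_connected C_disk e e'.
have fE : fiber_map f e = phi e by exact: val_inj.
(* Both maps are equivariant and agree at [e], hence at its translate by [a]. *)
by have := gmapE phi a e; rewrite /= fiber_map_equivariant fE => ->.
Qed.
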